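(* There exist constants $c>0$ and $N$ such that for every $n\ge N$, every $d$, every connected $d$-regular graph $G$ on $n$ vertices with (finite) mixing time $t_m$, and every integer $1\le k\le n$, $$S^k(G)\ge c\cdot\frac{k}{t_m\ln n},$$ i.e. $S^k(G)=\Omega\!\left(\frac{k}{t_m\ln n}\right)$ for $k\le n$.
   Context: A simple random walk on a finite graph moves at each step from the current vertex to a uniformly random neighbor. For a finite connected graph $G$, a vertex $i$ and an integer $k\ge 1$, let $\tau_i^k$ be the first time by which every vertex of $G$ has been visited by at least one of $k$ independent simple random walks, all started at $i$ at time $0$ and moving simultaneously (the vertex occupied at time $0$ counts as visited). Put $C_i^k=E[\tau_i^k]$, $C^k(G)=\max_i C_i^k$, and $C(G)=C^1(G)$ (the cover time). The speed-up is $S^k(G)=C(G)/C^k(G)$. Let $p^t_{u,v}$ be the probability that the simple random walk started at $u$ is at $v$ at time $t$, and $\pi$ the stationary distribution. The mixing time $t_m$ of $G$ is the smallest integer $t>0$ such that $\sum_v|p^t_{u,v}-\pi(v)|<1/\mathrm e$ for all vertices $u$. *)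

(* Defs.v *)
From HB Require Import structures.
From mathcomp Require Export all_boot all_order all_algebra.
From mathcomp Require Export all_classical all_reals all_analysis.
Export Order.TTheory GRing.Theory Num.Theory numFieldNormedType.Exports.

Set Implicit Arguments.
Unset Strict Implicit.
Unset Printing Implicit Defensive.

Local Open Scope classical_set_scope.
Local Open Scope ring_scope.

Definition simple_graph (T : finType) (e : rel T) : Prop :=
  symmetric e /\ irreflexive e.

Definition connected_graph (T : finType) (e : rel T) : Prop :=
  forall u v : T, connect e u v.

Definition degree (T : finType) (e : rel T) (u : T) : nat := #|e u|.

Definition regular_graph (T : finType) (e : rel T) (d : nat) : Prop :=
  forall u : T, degree e u = d.

Definition step (R : realType) (T : finType) (e : rel T) (u v : T) : R :=
  if e u v then (degree e u)%:R^-1 else 0.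

Fixpoint nstep (R : realType) (T : finType) (e : rel T) (t : nat) (u v : T) : R :=
  if t is s.+1 then \sum_(w : T) nstep R e s u w * step R e w v
  else (u == v)%:R.

Definition stationary (R : realType) (T : finType) (e : rel T) (pi : T -> R) : Prop :=
  [/\ forall v, 0 <= pi v, \sum_v pi v = 1 &
      forall v, \sum_u pi u * step R e u v = pi v].

Definition mixed_at (R : realType) (T : finType) (e : rel T) (pi : T -> R)
    (t : nat) : Prop :=
  forall u : T, \sum_(v : T) `|nstep R e t u v - pi v| < (expR 1)^-1.

(* A graph such as a bipartite one has no mixing time: the predicate then holds
   for no [tm]. *)
Definition mixing_time (R : realType) (T : finType) (e : rel T) (pi : T -> R)
    (tm : nat) : Prop :=
  [/\ (0 < tm)%N, mixed_at e pi tm &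
      forall t : nat, (0 < t)%N -> mixed_at e pi t -> (tm <= t)%N].

Section Walks.
Context {R : realType} {T : finType} (e : rel T).

(* The last clause is the Markov property in product form: conditionally on the
   trajectory [x 0, ..., x t], the next vertex is [x t.+1] with probability
   [step R e (x t) (x t.+1)]. *)
Definition simple_random_walk (i : T) d (Omega : measurableType d)
    (P : probability Omega R) (X : nat -> Omega -> T) : Prop :=
  [/\ forall t v, measurable (X t @^-1` [set v]),
      P [set w | X 0%N w = i] = 1%E &
      forall (t : nat) (x : nat -> T),
        P [set w | forall s, (s <= t.+1)%N -> X s w = x s] =
        (P [set w | forall s, (s <= t)%N -> X s w = x s]
          * (step R e (x t) (x t.+1))%:E)%E].

Definition process_sigma d (Omega : measurableType d) (X : nat -> Omega -> T) :
    set (set Omega) :=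
  <<s [set A | exists t v, A = X t @^-1` [set v]] >>.

(* [A j] may be the whole space, so the product rule over all of ['I_k] contains
   the one over any subfamily. *)
Definition independent_processes d (Omega : measurableType d)
    (P : probability Omega R) (k : nat) (X : 'I_k -> nat -> Omega -> T) : Prop :=
  forall A : 'I_k -> set Omega,
    (forall j, process_sigma (X j) (A j)) ->
    P (\bigcap_(j in setT) A j) = (\prod_(j < k) P (A j))%E.

Record walks (k : nat) (i : T) := Walks {
  walks_display : measure_display;
  walks_space : measurableType walks_display;
  walks_prob : probability walks_space R;
  walk : 'I_k -> nat -> walks_space -> T;
  walk_srw : forall j, simple_random_walk i walks_prob (walk j);
  walk_indep : independent_processes walks_prob walk }.

(* [+oo] on the event that some vertex is never visited. *)
Definition cover_tau k i (W : walks k i) (w : walks_space W) : \bar R :=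
  ereal_inf [set (t%:R)%:E | t in
    [set t : nat | forall v : T, exists j s, (s <= t)%N /\ walk j s w = v]].

Definition expected_cover k i (W : walks k i) : \bar R :=
  (\int[walks_prob W]_w cover_tau w)%E.

(* These depend on the realizations [W] only through the laws of the walks,
   which [k], [e] and the starting vertex determine. *)
Definition cover_time k (W : forall i : T, walks k i) : \bar R :=
  (\big[maxe/-oo]_(i : T) expected_cover (W i))%E.

Definition speedup k (W1 : forall i : T, walks 1 i) (Wk : forall i : T, walks k i) :
    \bar R :=
  (cover_time W1 / cover_time Wk)%E.

End Walks.

Arguments walks R {T} e k i.

(* Main.v *)
(** The numerator needs only the trivial bound C(G) >= n - 1. For the
    denominator let L = 2 t_m. The rows p^(t_m)(u,.) and p^(t_m)(v,.) overlap in
    mass at least 1 - 1/e >= 1/2, so reversibility and Cauchy-Schwarz give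
    p^L(u,v) >= 1/(4n) for all u, v. By the Markov property one walk misses a
    fixed vertex at the times L, 2L, ..., mL with probability at most
    (1 - 1/(4n))^m; by independence and a union bound the k walks leave some
    vertex unvisited at time mL with probability at most n (1 - 1/(4n))^(mk).
    Summing the tail of the cover time yields C^k = O(t_m n ln n / k). *)
Require Import Defs.
From mathcomp Require Import ring lra zify.
Local Open Scope ring_scope.

Set Implicit Arguments.
Unset Strict Implicit.
Unset Printing Implicit Defensive.

Local Open Scope classical_set_scope.

(** * The transition kernel of a regular graph and its mixing *)

Section GraphKernel.
Context {R : realType} {T : finType} (e : rel T).

Lemma step_ge0 u v : 0 <= step R e u v.
Proof. by rewrite /step; case: ifP => // _; rewrite invr_ge0 ler0n. Qed.

Lemma nstep_ge0 t u v : 0 <= nstep R e t u v.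
Proof.
elim: t v => [|t IH] v /=; first exact: ler0n.
by apply: sumr_ge0 => w _; rewrite mulr_ge0 ?step_ge0.
Qed.

Lemma nstepD s t u v :
  nstep R e (s + t) u v = \sum_w nstep R e s u w * nstep R e t w v.
Proof.
elim: t v => [|t IH] v.
  rewrite addn0 (bigD1 v)//= eqxx mulr1 big1 ?addr0// => w /negbTE wv.
  by rewrite wv mulr0.
rewrite addnS /=; under eq_bigr do rewrite IH mulr_suml.
rewrite exchange_big; apply: eq_bigr => w _ /=.
by rewrite mulr_sumr; apply: eq_bigr => x _; rewrite mulrA.
Qed.

Lemma nstep_sum1 d t u : (0 < d)%N -> regular_graph e d ->
  \sum_v nstep R e t u v = 1.
Proof.
move=> d0 reg; elim: t => [|t IH] /=.
  by rewrite (bigD1 u)//= eqxx big1 ?addr0// => v; rewrite eq_sym => /negbTE ->.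
rewrite exchange_big -[RHS]IH; apply: eq_bigr => w _ /=.
rewrite -mulr_sumr [X in _ * X](_ : _ = 1) ?mulr1//.
rewrite /step -big_mkcond/= sumr_const reg -[#|_|]/(degree e w) reg.
by rewrite -[_ *+ _]mulr_natr mulVf// pnatr_eq0 -lt0n.
Qed.

(** Regularity makes [step] symmetric; the induction matches the last step taken from [u] with the
    first step taken from [v]. *)
Lemma nstep_sym d t u v : symmetric e -> regular_graph e d ->
  nstep R e t u v = nstep R e t v u.
Proof.
move=> sym reg.
have step_sym x y : step R e x y = step R e y x by rewrite /step sym !reg.
elim: t u v => [|t IH] u v; first by rewrite /= eq_sym.
rewrite -[in RHS]add1n nstepD /=; apply: eq_bigr => w _.
rewrite IH mulrC step_sym; congr (_ * _).
rewrite (bigD1 v)//= eqxx mul1r big1 ?addr0// => x; rewrite eq_sym.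
by move=> /negbTE ->; rewrite mul0r.
Qed.

(** Each row is within 1/e <= 1/2 of [pi] in l1 norm, so two rows are at distance at most 1. Since
    min(a, b) = (a + b - |a - b|) / 2 and each row sums to 1, the overlap is at least (2 - 1) /
    2. *)
Lemma mixed_overlap d (pi : T -> R) t u v : (0 < d)%N -> regular_graph e d ->
  mixed_at e pi t ->
  2^-1 <= \sum_w Num.min (nstep R e t u w) (nstep R e t v w).
Proof.
move=> d0 reg mix.
have einv : (expR 1)^-1 <= 2^-1 :> R.
  by rewrite lef_pV2 ?posrE ?expR_gt0//; have := expR_ge1Dx (1 : R).
have dist : \sum_w `|nstep R e t u w - nstep R e t v w| <= 1.
  have -> : 1 = 2^-1 + 2^-1 :> R by lra.
  apply: le_trans (lerD (le_trans (ltW (mix u)) einv)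
                        (le_trans (ltW (mix v)) einv)).
  rewrite -big_split/=; apply: ler_sum => w _.
  by rewrite [`|nstep R e t v w - _|]distrC; exact: ler_distD.
have minE w : Num.min (nstep R e t u w) (nstep R e t v w) =
    2^-1 * (nstep R e t u w + nstep R e t v w
            - `|nstep R e t u w - nstep R e t v w|).
  by case: leP => h; [rewrite ler0_norm ?subr_le0//|rewrite gtr0_norm ?subr_gt0//]; lra.
under eq_bigr do rewrite minE.
rewrite -mulr_sumr big_split big_split/= sumrN !(nstep_sum1 _ _ d0 reg).
by lra.
Qed.

(* By symmetry [p^(2t)(u,v)] is the inner product of the rows [p^t(u,.)] and
   [p^t(v,.)], hence at least the squared norm of their minimum [m]; pointwise
   [m^2 >= m/n - 1/(4n^2)] and [m] has mass at least 1/2. *)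
Lemma nstep_double_ge d (pi : T -> R) t u v : (0 < d)%N -> symmetric e ->
  regular_graph e d -> mixed_at e pi t ->
  (4 * #|T|%:R)^-1 <= nstep R e (t + t) u v.
Proof.
move=> d0 sym reg mix; rewrite nstepD.
have n0 : 0 < #|T|%:R :> R by rewrite ltr0n; apply/card_gt0P; exists u.
set n := #|T|%:R in n0 *.
pose m w := Num.min (nstep R e t u w) (nstep R e t v w).
apply: (@le_trans _ _ (\sum_w (m w / n - (4 * n ^+ 2)^-1))).
  rewrite sumrB -mulr_suml sumr_const -(mulr_natr _ #|T|) -/n.
  have := mixed_overlap u v d0 reg mix; rewrite -/m => mge.
  have -> : (4 * n)^-1 = 2^-1 / n - (4 * n ^+ 2)^-1 * n by field; lra.
  by rewrite lerB// ler_wpM2r// invr_ge0 ltW.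
apply: ler_sum => w _.
rewrite (nstep_sym t w v sym reg); apply: (@le_trans _ _ (m w ^+ 2)).
  rewrite -subr_ge0.
  have -> : m w ^+ 2 - (m w / n - (4 * n ^+ 2)^-1) = (m w - (2 * n)^-1) ^+ 2.
    by field; lra.
  exact: sqr_ge0.
by rewrite expr2 ler_pM// /m ?le_min ?nstep_ge0// ge_min lexx ?orbT.
Qed.

Lemma regular_degree_gt0 d : connected_graph e -> regular_graph e d ->
  (1 < #|T|)%N -> (0 < d)%N.
Proof.
move=> conn reg /card_gt1P[u [v [_ _ uv]]].
have /connectP[[|x p] /=] := conn u v; first by move=> _ vu; rewrite vu eqxx in uv.
case/andP=> eux _ _; rewrite -(reg u) /degree.
by apply/card_gt0P; exists x.
Qed.

End GraphKernel.

(** * The Markov property, and the probability that one walk misses a vertex *)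

Lemma measure_fibers (R : realType) d (Omega : measurableType d)
    (P : probability Omega R) (I : finType) (f : Omega -> I)
    (A : set Omega) : measurable A ->
  (forall i, measurable (f @^-1` [set i])) ->
  P A = (\sum_i P (A `&` f @^-1` [set i]))%E.
Proof.
move=> mA mf.
have AE : A = \bigcup_(i in [set` index_enum I]) (A `&` f @^-1` [set i]).
  apply/seteqP; split => [w Aw|w [i _ []]//].
  by exists (f w) => //=; exact: mem_index_enum.
rewrite {1}AE measure_fin_bigcup//.
- by rewrite -fsbig_seq// index_enum_uniq.
- by move=> i j _ _ [w /= [[_ <-] [_ <-]]].
- by move=> i _; exact: measurableI.
Qed.

Section Markov.
Context {R : realType} {T : finType} (e : rel T) (i : T).
Context {d} {Omega : measurableType d} (P : probability Omega R).
Context (X : nat -> Omega -> T) (srw : simple_random_walk e i P X).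

(** Events decided by the past up to time [t], encoded as invariance under equal pasts. As [T] is
    finite, such a set is a finite union of trajectory fibers, so its measurability comes for
    free. *)
Definition adapted (t : nat) (A : set Omega) : Prop :=
  forall w w', (forall s, (s <= t)%N -> X s w = X s w') -> A w -> A w'.

Let trajectory (t : nat) (w : Omega) : {ffun 'I_t.+1 -> T} :=
  [ffun s : 'I_t.+1 => X s w].

Let trajectory_fiber t (x : {ffun 'I_t.+1 -> T}) :
  trajectory t @^-1` [set x] =
  [set w | forall s, (s <= t)%N -> X s w = x (inord s)].
Proof.
apply/seteqP; split => [w /= <- s st|w /= Xx].
  by rewrite ffunE inordK.
by apply/ffunP => s; rewrite ffunE Xx ?inord_val// -ltnS.
Qed.

Let measurable_walk t v : measurable (X t @^-1` [set v]).
Proof. by case: srw. Qed.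

Let measurable_trajectory t (x : {ffun 'I_t.+1 -> T}) :
  measurable (trajectory t @^-1` [set x]).
Proof.
have -> : trajectory t @^-1` [set x] =
    \bigcap_(s : 'I_t.+1) (X s @^-1` [set x s]).
  apply/seteqP; split => [w /= <- s _ /=|w /= Xx]; first by rewrite ffunE.
  by apply/ffunP => s; rewrite ffunE; exact: (Xx s).
by apply: fin_bigcap_measurable => // s _; exact: measurable_walk.
Qed.

Let adapted_fiber t A (x : {ffun 'I_t.+1 -> T}) : adapted t A ->
  A `&` trajectory t @^-1` [set x] = set0 \/
  A `&` trajectory t @^-1` [set x] = trajectory t @^-1` [set x].
Proof.
move=> adA; have [[w [Aw wx]]|none] :=
    pselect (exists w, (A `&` trajectory t @^-1` [set x]) w); last first.
  by left; apply/seteqP; split => // w Aw; case: none; exists w.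
right; apply/setIidr => w' w'x; apply: adA Aw => s st.
move: wx w'x => /= <- /ffunP /(_ (inord s)).
by rewrite !ffunE inordK// => ->.
Qed.

Lemma measurable_adapted t A : adapted t A -> measurable A.
Proof.
move=> adA.
have -> : A = \bigcup_(x : {ffun 'I_t.+1 -> T}) (A `&` trajectory t @^-1` [set x]).
  apply/seteqP; split => [w Aw|w [x _ []]//].
  by exists (trajectory t w).
apply: fin_bigcup_measurable => // x _.
by have [->|->] := adapted_fiber x adA.
Qed.

(** [simple_random_walk] gives the Markov property for single trajectories only. Splitting [A] into
    trajectory fibers extends it to every adapted event on which the current position is fixed. *)
Lemma adapted_step t A y z : adapted t A -> A `<=` X t @^-1` [set y] ->
  P (A `&` X t.+1 @^-1` [set z]) = (P A * (step R e y z)%:E)%E.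
Proof.
move=> adA Ay; have mA := measurable_adapted adA.
rewrite (measure_fibers P (measurableI _ _ mA (measurable_walk _ _))
  (measurable_trajectory (t := t))).
rewrite (measure_fibers P mA (measurable_trajectory (t := t))).
rewrite ge0_sume_distrl//; apply: eq_bigr => x _.
rewrite setIAC; have [A0|] := adapted_fiber x adA.
  by rewrite A0 set0I measure0 mul0e.
have [xt|xt Ax] := eqVneq (x ord_max) y; last first.
  suff -> : A `&` trajectory t @^-1` [set x] = set0.
    by rewrite set0I measure0 mul0e.
  apply/seteqP; split => // w [/Ay /= Xy /= wx].
  by move/eqP: xt; apply; rewrite -wx ffunE.
(* The trajectory [x] is prolonged by [z]; only its values up to time t + 1 matter. *)
move=> ->; have [_ _ /(_ t (fun s => if (s <= t)%N then x (inord s) else z))] := srw.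
rewrite leqnn ltnn.
have -> : inord t = ord_max :> 'I_t.+1 by apply/val_inj; rewrite /= inordK.
rewrite xt => /= Pxz; rewrite trajectory_fiber.
have -> : [set w | forall s, (s <= t)%N -> X s w = x (inord s)] `&`
    X t.+1 @^-1` [set z] =
    [set w | forall s, (s <= t.+1)%N ->
      X s w = if (s <= t)%N then x (inord s) else z].
  apply/seteqP; split => [w [/= Xx Xz] s|w /= Xxz].
    by rewrite leq_eqVlt ltnS => /predU1P[->|st]; [rewrite ltnn|rewrite st Xx].
  by split => [s st|]; [rewrite Xxz ?st// leqW|rewrite Xxz// ltnn].
rewrite Pxz; congr (P _ * _)%E; apply/seteqP.
by split => w /= h s st; have := h s st; rewrite st.
Qed.

(** Splitting according to the position at time t + s reduces the next step to [adapted_step],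
    because [A] together with that position is adapted to t + s. *)
Lemma adapted_nstep s t A y z : adapted t A -> A `<=` X t @^-1` [set y] ->
  P (A `&` X (t + s)%N @^-1` [set z]) = (P A * (nstep R e s y z)%:E)%E.
Proof.
move=> adA Ay; elim: s z => [|s IH] z.
  rewrite addn0 /=; case: eqVneq => [<-|yz]; first by rewrite setIidl ?mule1.
  rewrite mule0 (_ : _ `&` _ = set0) ?measure0//.
  by apply/seteqP; split => // w [/Ay /= -> /eqP]; exact/negP.
have mA := measurable_adapted adA.
rewrite (measure_fibers P (measurableI _ _ mA (measurable_walk _ _))
  (measurable_walk (t + s))).
rewrite /= -sumEFin ge0_sume_distrr; last first.
  by move=> w _; rewrite lee_fin mulr_ge0 ?nstep_ge0 ?step_ge0.
apply: eq_bigr => w _; rewrite setIAC EFinM muleA -IH addnS.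
apply: adapted_step => [|x []//] => x x' xx' [Ax Xw]; split.
  by apply: adA Ax => r rt; apply: xx'; rewrite (leq_trans rt)// leq_addr.
by rewrite /= -xx'.
Qed.

(** Time 0 is excluded, so that the event consists of exactly [m] trials, each preceded by [L] steps
    of the walk. *)
Definition miss (L m : nat) (v : T) : set Omega :=
  [set w | forall r, (r <= m)%N -> (0 < r)%N -> X (r * L) w != v].

Lemma adapted_miss L m v : adapted (m * L) (miss L m v).
Proof.
move=> w w' ww' missw r rm r0; rewrite -ww' ?missw//.
exact: leq_mul.
Qed.

Lemma measurable_miss L m v : measurable (miss L m v).
Proof. exact: (measurable_adapted (@adapted_miss L m v)). Qed.

(** Whatever the position at time mL, the next trial hits [v] with probability at least [p], so each
    further trial multiplies the probability of missing by at most 1 - p. *)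
Lemma miss_le L m v p : 0 <= p <= 1 -> (forall u, p <= nstep R e L u v) ->
  (P (miss L m v) <= ((1 - p) ^+ m)%:E)%E.
Proof.
move=> /andP[p0 p1] Lp; elim: m => [|m IH].
  by rewrite expr0 probability_le1//; exact: measurable_miss.
have mM := measurable_miss L m v.
have PM := fin_num_measure P _ mM.
(* Condition on the position at time mL; the bound [p] is uniform in it. *)
have hit : ((fine (P (miss L m v)) * p)%:E <=
    P (miss L m v `&` X (m * L + L)%N @^-1` [set v]))%E.
  rewrite (measure_fibers P (measurableI _ _ mM (measurable_walk _ _))
    (measurable_walk (m * L))).
  rewrite EFinM fineK// (measure_fibers P mM (measurable_walk (m * L))).
  rewrite ge0_sume_distrl//; apply: lee_sum => y _.
  rewrite setIAC (@adapted_nstep _ _ _ y)//.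
    by rewrite lee_pmul ?lee_fin.
  move=> w w' ww' [Mw Xw]; split; first exact: (adapted_miss ww' Mw).
  by rewrite /= -ww'.
have split_miss : miss L m v =
    miss L m.+1 v `|` (miss L m v `&` X (m * L + L)%N @^-1` [set v]).
  apply/seteqP; split => [w Mw|w [Mw r rm r0|[]//]].
    have [Xv|Xv] := eqVneq (X (m * L + L)%N w) v; [by right; split|left => r].
    rewrite leq_eqVlt => /predU1P[->|rm] r0; last exact: Mw.
    by rewrite mulSn addnC.
  by apply: Mw => //; exact: leqW.
have mH : measurable (miss L m v `&` X (m * L + L)%N @^-1` [set v]).
  exact: measurableI.
have mM1 := measurable_miss L m.+1 v.
have PD : P (miss L m v) = (P (miss L m.+1 v) +
    P (miss L m v `&` X (m * L + L)%N @^-1` [set v]))%E.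
  rewrite {1}split_miss measureU//; apply/seteqP; split => // w [Mw [_ Xv]].
  by have := Mw m.+1 (leqnn _) isT; rewrite mulSn addnC Xv eqxx.
move: hit IH PD; rewrite -(fineK PM) -(fineK (fin_num_measure P _ mM1)).
rewrite -(fineK (fin_num_measure P _ mH)) !lee_fin /= => hit IH [PD].
rewrite exprS; apply: le_trans (ler_wpM2l _ IH); last by lra.
by lra.
Qed.
End Markov.

(** * The cover time as a tail sum, and the union bound for k walks *)

Section CoverTime.
Context {R : realType} {T : finType} (e : rel T) (k : nat) (i : T).
Context (W : walks R e k i).

Local Notation P := (walks_prob W).

Definition covered (t : nat) (w : walks_space W) : Prop :=
  forall v : T, exists j s, (s <= t)%N /\ walk j s w = v.

Definition uncovered (t : nat) : set (walks_space W) := ~` [set w | covered t w].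

Lemma covered_le s t w : (s <= t)%N -> covered s w -> covered t w.
Proof.
move=> st cs v; have [j [r [rs <-]]] := cs v.
by exists j, r; split => //; exact: leq_trans st.
Qed.

Lemma uncovered_le s t : (s <= t)%N -> uncovered t `<=` uncovered s.
Proof. by move=> st w /= ut cs; apply: ut; exact: covered_le cs. Qed.

Lemma measurable_uncovered t : measurable (uncovered t).
Proof.
have -> : uncovered t = \bigcup_(v : T) \bigcap_(j : 'I_k)
    \bigcap_(s : 'I_t.+1) ~` (walk j s @^-1` [set v] : set (walks_space W)).
  apply/seteqP; split => [w /= /existsNP[v nv]|w /= [v _ nv] cov].
    exists v => // j _ s _ /= jsv; apply: nv.
    by exists j, s; split => //; rewrite -ltnS.
  have [j [s [st jsv]]] := cov v.
  by apply: (nv j I (Ordinal (st : (s < t.+1)%N))).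
apply: fin_bigcup_measurable => // v _; apply: fin_bigcap_measurable => // j _.
apply: fin_bigcap_measurable => // s _; apply: measurableC.
by have [] := walk_srw W j.
Qed.

(** The cover time counts the times 0, 1, 2, ... at which some vertex is still unvisited. *)
Lemma cover_tauE w : cover_tau w = (\sum_(t <oo) (\1_(uncovered t) w)%:E)%E.
Proof.
have -> : cover_tau w =
    ereal_inf [set (t%:R : R)%:E | t in [set t | covered t w]] by [].
have u0 t : (0 <= (\1_(uncovered t) w)%:E :> \bar R)%E.
  by rewrite lee_fin indicE.
have [[t ct]|never] := pselect (exists t, covered t w); last first.
  (* Without covering, the infimum of the empty set is [+oo], and the partial sums of ones are
     unbounded. *)
  rewrite (_ : [set t | covered t w] = set0); last first.
    by apply/seteqP; split => // t ct; case: never; exists t.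
  rewrite image_set0 ereal_inf0; apply/esym; apply: eq_infty => r.
  apply: (@le_trans _ _ (\sum_(0 <= t < (Num.truncn r).+1)
    (\1_(uncovered t) w)%:E)%E); last exact: nneseries_lim_ge.
  under eq_bigr => t _.
    rewrite indicE mem_set; last by move=> ct; apply: never; exists t.
    over.
  rewrite sumEFin lee_fin sumr_const_nat subn0 ltW//.
  exact: truncnS_gt.
have ext : exists t, `[< covered t w >] by exists t; exact/asboolP.
case: (ex_minnP ext) => m /asboolP cm min_m.
(* At the first covering time [m] the series splits into [m] ones and a zero tail. *)
rewrite (nneseries_split 0 m) => [|t' _]; last exact: u0.
rewrite add0n [X in (_ + X)%E]eseries0 ?adde0; last first.
  move=> t' mt _; rewrite indicE memNset//= => nc; apply: nc.
  exact: covered_le cm.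
rewrite big_nat_cond (eq_bigr (fun=> 1%:E)); last first.
  move=> t' /andP[/andP[_ tm] _]; rewrite indicE mem_set// => ct'.
  by have := min_m t' (introT (asboolP _) ct'); rewrite leqNgt tm.
rewrite -big_nat_cond sumEFin sumr_const_nat subn0.
apply/eqP; rewrite eq_le; apply/andP; split.
  by apply: ereal_inf_lbound; exists m.
apply: le_ereal_inf_tmp => _ [t' ct' <-]; rewrite lee_fin ler_nat.
by apply: min_m; apply/asboolP.
Qed.

Lemma expected_coverE : expected_cover W = (\sum_(t <oo) P (uncovered t))%E.
Proof.
rewrite /expected_cover; under eq_integral do rewrite cover_tauE.
rewrite integral_nneseries//.
- apply: eq_eseriesr => t _; rewrite integral_indic ?setIT//.
  exact: measurable_uncovered.
- move=> t; apply/measurable_realfun.measurable_EFinP.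
  by apply: measurable_realfun.measurable_indic; exact: measurable_uncovered.
Qed.

(** Independence speaks only of events generated by a single walk. The event is written as the
    complement of a countable union, padded with empty sets, to fit the closure rules of a generated
    sigma-algebra. *)
Lemma miss_process_sigma (j : 'I_k) L m v :
  process_sigma (walk j : nat -> walks_space W -> T) (miss (walk j) L m v).
Proof.
have [s0 sC sU] := smallest_sigma_algebra [set: walks_space W]
  [set A | exists t u, A = (walk j t : walks_space W -> T) @^-1` [set u]].
rewrite /process_sigma.
have -> : miss (walk j) L m v = [set: walks_space W] `\`
    \bigcup_r (if (0 < r <= m)%N then walk j (r * L) @^-1` [set v] else set0).
  apply/seteqP; split => [w mw|w [_ nw] r rm r0].
    split => // -[r _]; case: ifP => // /andP[r0 rm] /= /eqP.
    by apply/negP; exact: mw.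
  by apply/eqP => jv; apply: nw; exists r => //; rewrite r0 rm.
apply: sC; apply: sU => r; case: ifP => // _.
by apply: sub_sigma_algebra; exists (r * L)%N, v.
Qed.

(** If covering fails by time mL, some vertex is missed by all walks at the multiples of [L]. A
    union bound over vertices gives the factor [#|T|], and independence turns the joint miss into a
    product of [k] factors. *)
Lemma uncovered_prob_le L m p : 0 <= p <= 1 ->
  (forall u v, p <= nstep R e L u v) ->
  (P (uncovered (m * L)) <= (#|T|%:R * (1 - p) ^+ (m * k))%:E)%E.
Proof.
move=> p01 Lp.
have mM v (j : 'I_k) : measurable (miss (walk j : nat -> walks_space W -> T) L m v).
  exact: (measurable_miss (walk_srw W j)).
apply: (@le_trans _ _ (\sum_(v : T) P (\bigcap_(j : 'I_k) miss (walk j) L m v))%E).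
  rewrite [leRHS]fsbig_seq ?index_enum_uniq//.
  apply: content_sub_fsum => //.
  - by move=> v _; exact: fin_bigcap_measurable.
  - exact: measurable_uncovered.
  move=> w /= /existsNP[v nv]; exists v; first exact: mem_index_enum.
  move=> j _ r rm r0; apply/eqP => jv; apply: nv.
  by exists j, (r * L)%N; split => //; rewrite leq_mul2r rm orbT.
rewrite mulr_natl -sumr_const -sumEFin; apply: lee_sum => v _.
rewrite (walk_indep (w := W)) => [|j]; last exact: miss_process_sigma.
have miss_fin j : P (miss (walk j) L m v) \is a fin_num by exact: fin_num_measure.
under eq_bigr => j _ do rewrite -(fineK (miss_fin j)).
rewrite prodEFin lee_fin exprM -[X in _ ^+ X]card_ord -prodr_const.
apply: ler_prod => j _; rewrite fine_ge0//= -lee_fin fineK//.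
exact: (miss_le (walk_srw W j)).
Qed.

End CoverTime.

(** * From tail probabilities to bounds on the expected cover time *)

(** Each block of length [L] is bounded by [L] times its first, hence largest, term. *)
Lemma sum_block_le (R : numDomainType) (u : nat -> R) (L M : nat) :
  {homo u : s t / (s <= t)%N >-> t <= s} ->
  \sum_(0 <= t < M * L) u t <= L%:R * \sum_(0 <= m < M) u (m * L)%N.
Proof.
move=> u_anti; elim: M => [|M IH]; first by rewrite mul0n !big_geq// mulr0.
rewrite mulSn addnC (@big_cat_nat _ _ _ (M * L))//= ?leq_addr//.
rewrite big_nat_recr//= mulrDr lerD//.
apply: (@le_trans _ _ (\sum_(M * L <= t < M * L + L) u (M * L)%N)).
  by rewrite ler_sum_nat// => t /andP[? _]; exact: u_anti.
by rewrite sumr_const_nat addKn mulr_natl.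
Qed.

(** The first [m0] terms cost at most 1 each; the remaining ones are dominated by a geometric
    series. *)
Lemma sum_truncated_geometric_le (R : realFieldType) (q : R) (a : nat -> R)
    (m0 M : nat) : 0 <= q < 1 -> (forall m, a m <= 1) ->
  (forall m, a (m0 + m)%N <= q ^+ m) ->
  \sum_(0 <= m < M) a m <= m0%:R + (1 - q)^-1.
Proof.
move=> /andP[q0 q1]; elim: m0 a M => [|m0 IH] a M a1 aq; last first.
  case: M => [|M].
    by rewrite big_geq// addr_ge0 ?ler0n// invr_ge0 subr_ge0 ltW.
  rewrite big_nat_recl// -natr1 addrAC addrC lerD//.
  by apply: IH => m //; exact: aq.
rewrite add0r; apply: (@le_trans _ _ (\sum_(0 <= m < M) q ^+ m)).
  by apply: ler_sum => m _; exact: aq.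
rewrite big_mkord -[leRHS]mul1r ler_pdivlMr ?subr_gt0//.
rewrite mulrC -opprB mulNr -subrX1 opprB.
by rewrite gerBl exprn_ge0.
Qed.

Section ExpectedCover.
Context {R : realType} {T : finType} (e : rel T).

(** By time [t] a single walk has seen at most t + 1 vertices, so covering is impossible at the
    first [#|T|.-1] times and each of them contributes 1 to the tail sum. *)
Lemma expected_cover_ge i (W : walks R e 1 i) :
  (((#|T|.-1)%:R : R)%:E <= expected_cover W)%E.
Proof.
rewrite expected_coverE.
apply: (@le_trans _ _ (\sum_(0 <= t < #|T|.-1)
    walks_prob W (uncovered (W := W) t))%E); last first.
  by apply: nneseries_lim_ge => t _ _; exact: measure_ge0.
rewrite big_nat_cond (eq_bigr (fun=> 1%:E)); last first.
  move=> t /andP[/andP[_ tT] _]; rewrite -(probability_setT (walks_prob W)).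
  congr (walks_prob W _); apply/seteqP; split => // w _ cov.
  suff : (#|T| <= t.+1)%N by lia.
  have visit v : v \in [set walk ord0 (s : nat) w | s : 'I_t.+1]%SET.
    have [j [s [st <-]]] := cov v; rewrite (ord1 j).
    by apply/imsetP; exists (Ordinal (st : (s < t.+1)%N)).
  rewrite -cardsT -[leqRHS]card_ord; apply: leq_trans (leq_imset_card _ _).
  by apply/subset_leq_card/fintype.subsetP => v _; exact: visit.
by rewrite -big_nat_cond sumEFin sumr_const_nat subn0.
Qed.

(** After [m0] blocks the union-bound factor [#|T|] has been absorbed, and the tail then decays
    geometrically with ratio (1 - p)^k per block. *)
Lemma expected_cover_le k i (W : walks R e k i) L p m0 :
  0 <= p <= 1 -> (1 - p) ^+ k < 1 -> (forall u v, p <= nstep R e L u v) ->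
  #|T|%:R * (1 - p) ^+ (m0 * k) <= 1 -> (0 < L)%N ->
  (expected_cover W <= (L%:R * (m0%:R + (1 - (1 - p) ^+ k)^-1))%:E)%E.
Proof.
move=> p01 q1 Lp m0_big L0; have /andP[p0 p1] := p01.
have q0 : 0 <= (1 - p) ^+ k by rewrite exprn_ge0// subr_ge0.
pose u t := fine (walks_prob W (uncovered (W := W) t)).
have uE t : walks_prob W (uncovered (W := W) t) = (u t)%:E.
  by rewrite fineK//; apply: fin_num_measure; exact: measurable_uncovered.
have u0 t : 0 <= u t by rewrite -lee_fin -uE.
have u_anti : {homo u : s t / (s <= t)%N >-> t <= s}.
  move=> s t st; rewrite -lee_fin -!uE le_measure ?inE//;
    [exact: measurable_uncovered.. | exact: uncovered_le].
rewrite expected_coverE; under eq_eseriesr do rewrite uE.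
apply: lime_le; first by apply: is_cvg_nneseries => t _ _; rewrite lee_fin.
apply: nearW => M; rewrite sumEFin lee_fin.
(* As [L] is positive, the partial sum can be enlarged to a whole number of blocks. *)
apply: (@le_trans _ _ (\sum_(0 <= t < M * L) u t)).
  rewrite [leRHS](@big_cat_nat _ _ _ M)//= ?leq_pmulr// lerDl.
  by apply: sumr_ge0 => t _.
apply: le_trans (sum_block_le L M u_anti) _.
rewrite ler_wpM2l// (sum_truncated_geometric_le _ _ (a := fun m => u (m * L)%N))//.
- by rewrite q0.
- by move=> m; rewrite -lee_fin -uE probability_le1//; exact: measurable_uncovered.
move=> m; rewrite -lee_fin -uE; apply: le_trans (uncovered_prob_le _ _ p01 Lp) _.
rewrite lee_fin mulnDl exprD mulrA [(m * k)%N]mulnC (exprM _ k m).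
by rewrite ler_piMl// exprn_ge0.
Qed.

End ExpectedCover.

(** * Numerical estimates for the miss probabilities *)

(** With x = pk, (1 - p)^k <= exp(-x) <= 1/(1 + x), so the gap is at least x/(1 + x), which is at
    least x/2 when x <= 1. *)
Lemma miss_rate_gap (R : realType) (p : R) (k : nat) : 0 <= p <= 1 ->
  p * k%:R <= 1 -> p * k%:R / 2 <= 1 - (1 - p) ^+ k.
Proof.
move=> /andP[p0 p1]; have : 0 <= p * k%:R by rewrite mulr_ge0.
move xE : (p * k%:R) => x x0 x1.
have : (1 - p) ^+ k <= (1 + x)^-1.
  apply: (@le_trans _ _ (expR (- x))).
    rewrite -xE -mulNr expRM_natr lerXn2r ?nnegrE ?expR_ge0 ?subr_ge0//.
    exact: expR_ge1Dx.
  rewrite expRN lef_pV2 ?posrE ?expR_gt0//; first exact: expR_ge1Dx.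
  by lra.
have : x / 2 <= x / (1 + x) by rewrite ler_wpM2l// lef_pV2 ?posrE; lra.
have -> : x / (1 + x) = 1 - (1 + x)^-1 by field; apply: lt0r_neq0; lra.
by lra.
Qed.

(** Since (1 - p)^(m0 k) <= exp(-p m0 k), it suffices that m0 exceed ln n / (pk); truncation plus
    one does so. *)
Lemma miss_block_count (R : realType) (n p : R) (k : nat) : 1 <= n ->
  0 < p <= 1 -> (0 < k)%N ->
  exists2 m0 : nat, n * (1 - p) ^+ (m0 * k) <= 1 &
    m0%:R <= ln n / (p * k%:R) + 1.
Proof.
move=> n1 /andP[p0 p1] k0; have n0 : 0 < n by exact: lt_le_trans n1.
have x0 : 0 < p * k%:R by rewrite mulr_gt0 ?ltr0n.
have ln0 : 0 <= ln n / (p * k%:R) by rewrite divr_ge0 ?ln_ge0// ltW.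
exists (Num.truncn (ln n / (p * k%:R))).+1; last first.
  by rewrite -natr1 lerD2r; have /andP[] := truncn_itv ln0.
have := truncnS_gt (ln n / (p * k%:R)).
set m0 := _.+1; rewrite ltr_pdivrMr// => m0_gt.
rewrite -ler_pdivlMl// mulr1 -[n]lnK ?posrE// -expRN.
apply: (@le_trans _ _ (expR (- (p * (m0 * k)%:R)))).
  rewrite -mulNr expRM_natr lerXn2r ?nnegrE ?expR_ge0 ?subr_ge0//.
  exact: expR_ge1Dx.
by rewrite ler_expR lerN2 natrM mulrCA ltW.
Qed.

(** Put y = n/k, so that 1/(pk) = 4y. Then m0 <= 4 y ln n + 1 and the inverse gap is at most 8y; as
    1 <= y <= y ln n, the total is at most (4 + 1 + 8) y ln n. *)
Lemma miss_rate_bounds (R : realType) (n k : nat) (p : R) :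
  p = (4 * n%:R)^-1 -> (0 < k <= n)%N -> 1 <= ln (n%:R : R) ->
  [/\ 0 <= p <= 1, (1 - p) ^+ k < 1 &
      exists2 m0 : nat, n%:R * (1 - p) ^+ (m0 * k) <= 1 &
        m0%:R + (1 - (1 - p) ^+ k)^-1 <= 13 * (n%:R / k%:R * ln n%:R)].
Proof.
move=> pE /andP[k0 kn] ln1.
have n1 : 1 <= n%:R :> R by rewrite ler1n (leq_trans k0).
have k_gt0 : 0 < k%:R :> R by rewrite ltr0n.
have p0 : 0 < p by rewrite pE invr_gt0; lra.
have p1 : p <= 1 by rewrite pE invf_le1; lra.
have p01 : 0 <= p <= 1 by rewrite ltW.
have y1 : 1 <= n%:R / k%:R :> R by rewrite ler_pdivlMr// mul1r ler_nat.
have xV : (p * k%:R)^-1 = 4 * (n%:R / k%:R).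
  by rewrite pE invfM invrK mulrA.
have x0 : 0 < p * k%:R by rewrite mulr_gt0.
have x1 : p * k%:R <= 1 by rewrite -invf_ge1// xV; lra.
have gap := miss_rate_gap p01 x1.
have [m0 m0_big m0_le] : exists2 m0 : nat, n%:R * (1 - p) ^+ (m0 * k) <= 1 &
    m0%:R <= ln n%:R / (p * k%:R) + 1.
  by apply: miss_block_count => //; rewrite p0.
split=> //; first by lra.
exists m0 => //; apply: le_trans (lerD m0_le (_ : _ <= 8 * (n%:R / k%:R))) _.
  have -> : 8 * (n%:R / k%:R) = (p * k%:R / 2)^-1 by rewrite invf_div xV; ring.
  by rewrite lef_pV2 ?posrE//; lra.
have yl : n%:R / k%:R <= n%:R / k%:R * ln n%:R :> R.
  by rewrite ler_peMr// (le_trans ler01).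
rewrite xV; move: yl y1; set y := n%:R / k%:R => yl y1.
by rewrite [ln _ * _]mulrC -mulrA; lra.
Qed.

(** * Assembling the speed-up bound *)

Theorem theorem9 (R : realType) :
  exists (c : R) (N : nat), 0 < c /\
    forall (n d : nat) (T : finType) (e : rel T) (pi : T -> R) (tm k : nat)
      (W1 : forall i : T, walks R e 1 i) (Wk : forall i : T, walks R e k i),
      (N <= n)%N -> #|T| = n ->
      simple_graph e -> connected_graph e -> regular_graph e d ->
      stationary e pi -> mixing_time e pi tm ->
      (1 <= k)%N -> (k <= n)%N ->
      ((c * (k%:R / (tm%:R * ln n%:R)))%:E <= speedup W1 Wk)%E.
Proof.
(* The constant 52 is 2 * 26, from C >= n/2 and C^k <= 26 t_m (n/k) ln n. The threshold exceeds e,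
   giving ln n >= 1, and is at least 2. *)
exists (52%:R^-1), (Num.truncn (expR 1 : R)).+2; split; first by rewrite invr_gt0.
move=> n d T e pi tm k W1 Wk Nn Tn [sym _] conn reg _ [tm0 mix _] k1 kn.
have n2 : (1 < n)%N by exact: leq_trans Nn.
have d0 : (0 < d)%N by apply: (regular_degree_gt0 conn reg); rewrite Tn.
have k_gt0 : 0 < k%:R :> R by rewrite ltr0n.
have tm_gt0 : 0 < tm%:R :> R by rewrite ltr0n.
have n_gt0 : 0 < n%:R :> R by rewrite ltr0n ltnW.
have ln_ge1 : 1 <= ln n%:R :> R.
  rewrite -[leLHS](@expRK R) ler_ln ?posrE ?expR_gt0//.
  by apply: ltW; apply: lt_le_trans (truncnS_gt _) _; rewrite ler_nat ltnW.
have ln_gt0 : 0 < ln n%:R :> R by exact: lt_le_trans ln_ge1.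
have k1n : (0 < k <= n)%N by rewrite k1.
have [p01 q1 [m0 m0_big sum_le]] := miss_rate_bounds erefl k1n ln_ge1.
set p : R := (4 * n%:R)^-1 in p01 q1 m0_big sum_le.
have hit u v : p <= nstep R e (tm + tm) u v.
  by rewrite /p -Tn; exact: (nstep_double_ge u v d0 sym reg mix).
rewrite -Tn in m0_big.
have L0 : (0 < tm + tm)%N by rewrite addn_gt0 tm0.
(* Here 26 = 2 * 13: blocks have length 2 t_m, and their number is bounded with constant 13. *)
pose B : R := 26 * tm%:R * (n%:R / k%:R) * ln n%:R.
have BE : (tm + tm)%:R * (13 * (n%:R / k%:R * ln n%:R)) = B.
  by rewrite natrD /B; ring.
have B_gt0 : 0 < B by rewrite /B !mulr_gt0 ?invr_gt0.
have cover_le : (cover_time Wk <= B%:E)%E.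
  apply: bigmax_le => [|i _]; first by rewrite leNye.
  apply: le_trans (expected_cover_le (Wk i) p01 q1 hit m0_big L0) _.
  by rewrite lee_fin -BE ler_wpM2l.
have /card_gt0P[i _] : (0 < #|T|)%N by rewrite Tn ltnW.
(* For n >= 2, n - 1 >= n/2. *)
have cover1_ge : ((n%:R / 2)%:E <= cover_time W1)%E.
  apply: le_trans (le_bigmax _ _ i); apply: le_trans (expected_cover_ge _).
  rewrite lee_fin Tn ler_pdivrMr// -natrM ler_nat muln2 -addnn.
  by rewrite -{1}(prednK (ltnW n2)) -addn1 leq_add2l -ltnS prednK// ltnW.
(* Nonnegativity is what allows the upper bound [B] to be inverted in the extended reals. *)
have cover_ge0 : (0 <= cover_time Wk)%E.
  apply: le_trans (le_bigmax _ _ i); rewrite expected_coverE.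
  by apply: nneseries_ge0 => t _ _; exact: measure_ge0.
apply: (@le_trans _ _ ((n%:R / 2)%:E * (B^-1)%:E)%E).
  rewrite -EFinM lee_fin le_eqVlt; apply/orP; left; apply/eqP.
  by rewrite /B; field; rewrite !lt0r_neq0.
rewrite /speedup lee_pmul ?lee_fin ?divr_ge0 ?invr_ge0 ?(ltW B_gt0)//.
have -> : (B^-1)%:E = (B%:E^-1)%E by rewrite inver gt_eqF.
by rewrite lee_pV2 ?inE ?lee_fin ?(ltW B_gt0).
Qed.
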